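(* Consider the KdV-like equation $$u_{t}+\frac{3}{2}(u_{x})^2+\frac{3}{2}u^2u_{x}+\frac{3}{8}u^4=0 .$$ There are three classes of nonzero rational solutions $u$ of this equation generated from polynomial solutions of the bilinear equation $2f_{xt}f-2f_tf_x+6(f_{xx})^2=0$; that is, the nonzero functions of the form $u=2f_x/f$, with $f\in\mathbb{C}[x,t]$, $f\neq 0$, a solution of that bilinear equation, are solutions of the KdV-like equation, and they are exactly the functions $$u(x,t)=\frac{2}{x+c_{0}},$$ $$u(x,t)=\frac{2(9x^2+6c_{2}x+c_{2}^2)}{3x^3+3c_{2}x^2+c_{2}^2x+108t+3c_{0}},$$ and $$u(x,t)=\frac{2(48x^3+36c_{3}x^2+24c_{2}x+1728t+12c_{1})}{12x^4+12c_{3}x^3+12c_{2}x^2+1728tx+12c_{1}x+432c_{3}t+3c_{1}c_{3}-c_{2}^2},$$ with $c_{0},c_{1},c_{2},c_{3}\in\mathbb{C}$ arbitrary constants.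
   Context: Subscripts denote partial derivatives. A rational solution $u\in\mathbb{C}(x,t)$ is generated from a nonzero polynomial $f\in\mathbb{C}[x,t]$ when it is obtained by the logarithmic derivative transformation $u=2\,\partial_x\log f=2f_x/f$. *)

(* Defs.v *)
From HB Require Import structures.
From mathcomp Require Import all_boot all_order all_algebra.
From mathcomp Require Import reals.
From mathcomp Require Export complex.
From mathcomp Require Import ring.

Set Implicit Arguments.
Unset Strict Implicit.
Unset Printing Implicit Defensive.

Import GRing.Theory.
Local Open Scope ring_scope.

(* The extension of a derivation D of A to the fraction field of A by the
   quotient rule.  It is computed on the canonical representative of u;
   frac_derivE shows that every other representative gives the same value. *)
Definition frac_deriv (A : idomainType) (D : A -> A) (u : {fraction A}) :
    {fraction A} :=
  let n := \n_(repr u) in let d := \d_(repr u) in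
  tofrac (D n * d - n * D d) / tofrac (d ^+ 2).

Lemma tofrac_repr (A : idomainType) (u : {fraction A}) :
  u * tofrac \d_(repr u) = tofrac \n_(repr u).
Proof.
elim/quotW: u => r; set s := repr _; unlock FracField.tofrac.
rewrite -[LHS]FracField.pi_mul; apply/eqmodP.
rewrite /= FracField.equivfE /FracField.mulf.
rewrite !numden_Ratio ?mulr1 ?mulf_neq0 ?denom_ratioP ?oner_neq0 //.
by rewrite FracField.equivf_r.
Qed.

Lemma frac_derivE (A : idomainType) (D : A -> A)
    (Dleibniz : forall p q, D (p * q) = D p * q + p * D q) (n d : A) :
  d != 0 ->
  frac_deriv D (tofrac n / tofrac d) =
  tofrac (D n * d - n * D d) / tofrac (d ^+ 2).
Proof.
move=> d0; rewrite /frac_deriv; set u := _ / tofrac d.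
have := tofrac_repr u; have := denom_ratioP (repr u).
move: (\n_(repr u)) (\d_(repr u)) => m e e0 uE.
have cross : n * e = m * d.
  apply/eqP; rewrite -tofrac_eq !tofracM -uE /u mulrAC divfK //.
  by rewrite tofrac_eq0.
apply/eqP; rewrite eqr_div ?tofrac_eq0 ?expf_neq0 // -!tofracM tofrac_eq.
have Dcross : D n * e + n * D e = D m * d + m * D d by rewrite -!Dleibniz cross.
have Dm : D m * d = D n * e + n * D e - m * D d by rewrite Dcross addrK.
apply/eqP; transitivity (d * e * (D m * d) - (m * d) * (d * D e)).
  by ring.
rewrite Dm -cross; transitivity (e ^+ 2 * d * D n - e * D d * (m * d)).
  by ring.
by rewrite -cross; ring.
Qed.

(* For a realType R, the field C is R[i].  C[x,t] is encoded as C[t][x]: the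
   outer variable is x and the inner one is t. *)
Notation polyxt R := {poly {poly R[i]}}.
Notation ratxt R := {fraction polyxt R}.

Section PolynomialsAndRationalFunctions.
Variable R : realType.

Definition pdx (f : polyxt R) : polyxt R := f^`().
Definition pdt (f : polyxt R) : polyxt R := map_poly (@deriv R[i]) f.

Lemma pdx_leibniz p q : pdx (p * q) = pdx p * q + p * pdx q.
Proof. exact: derivM. Qed.

Lemma pdt_leibniz p q : pdt (p * q) = pdt p * q + p * pdt q.
Proof.
have cE r k : (pdt r)`_k = (r`_k)^`() by rewrite coef_map_id0 ?deriv0.
apply/polyP => k; rewrite coefD cE !coefM raddf_sum -big_split /=.
by apply: eq_bigr => i _; rewrite derivM !cE.
Qed.

Definition rdx : ratxt R -> ratxt R := frac_deriv pdx.
Definition rdt : ratxt R -> ratxt R := frac_deriv pdt.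

Definition ratx : ratxt R := tofrac 'X.
Definition ratt : ratxt R := tofrac ('X%:P).
Definition ratc (c : R[i]) : ratxt R := tofrac (c%:P%:P).

Definition kdv_like (u : ratxt R) : Prop :=
  rdt u + 3 / 2 * rdx u ^+ 2 + 3 / 2 * u ^+ 2 * rdx u + 3 / 8 * u ^+ 4 = 0.

Definition bilinear_kdv (f : polyxt R) : Prop :=
  2 * pdt (pdx f) * f - 2 * pdt f * pdx f + 6 * pdx (pdx f) ^+ 2 = 0.

Definition log_deriv_transform (f : polyxt R) : ratxt R :=
  2 * tofrac (pdx f) / tofrac f.

Definition generated_by_bilinear (u : ratxt R) : Prop :=
  exists f : polyxt R,
    [/\ f != 0, bilinear_kdv f & u = log_deriv_transform f].

End PolynomialsAndRationalFunctions.

(* Main.v *)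
Require Import Defs.
From mathcomp Require Import all_boot all_order all_algebra reals complex.
From mathcomp Require Import ring zify.
Set Implicit Arguments.
Unset Strict Implicit.
Unset Printing Implicit Defensive.
Import GRing.Theory Num.Theory.
Local Open Scope ring_scope.

(** Put H(f) = f_xt f - f_t f_x + 3 f_xx^2, so that the bilinear equation is
    2 H(f) = 0.  With v = f_x / f and u = 2 v one has f_xx / f = v_x + v^2 and
    H(f) / f^2 = v_t + 3 (v_x + v^2)^2, which is one half of the left-hand side
    of the KdV-like equation.  This gives the first claim ([kdv_of_bilinear]).

    For the classification, let f be a solution of degree n in x.

    Since H(l(t) f) = l(t)^2 H(f), a factor that depends on t alone is
    harmless, and such a factor can be removed: the leading coefficient l(t) of
    f divides f.  Indeed the coefficient of x^(n+i-1) in H(f) expresses the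
    Wronskian a_i' l - a_i l' through the coefficients of index above i; by
    descending induction it is p l^2 with p a polynomial, that is,
    (a_i / l)' = p, and so a_i / l is a polynomial.  The same induction bounds
    degrees: with weight 1 for x and weight 3 for t the operator H is
    homogeneous, and the quotient h = f / l, which is monic in x, has weight at
    most n ([monic_factor]).

    The top weight component of h is then a self-similar solution
    t^(n/3) F(x / t^(1/3)) with F monic of degree n, whose exponents are all
    congruent modulo 3.  The differential equation for F no longer involves n.
    It forces F = z^s (c + d z^3 + ...) with s <= 1 and c <> 0, then d = 0 or
    c = ((s + 3) (s + 2))^2 d, and finally the vanishing of all higher terms,
    because the linearised equation has no admissible exponent k >= 4.  Hence
    F is one of 1, z, z^3 + 36, z^4 + 144 z, and n is 0, 1, 3 or 4
    ([selfsim_size], [weighted_degree]).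

    A monic h of weight at most n <= 4 has few coefficients, all of them
    constants, and H(h) = 0 becomes a triangular system for them
    ([hirota_quartic], [hirota_solution]).  Its solutions with n > 0 are, up to
    a constant factor, the denominators of the three families; n = 0 gives
    u = 0. *)

(** * Extreme coefficients and the Euler operator *)

Lemma coefM_top (A : nzRingType) (p q : {poly A}) (a b : nat) :
  (size p <= a.+1)%N -> (size q <= b.+1)%N -> (p * q)`_(a + b) = p`_a * q`_b.
Proof.
move=> sp sq; have ltab : (a < (a + b).+1)%N by rewrite ltnS leq_addr.
rewrite coefM (bigD1 (Ordinal ltab)) //= addKn big1 ?addr0 // => i ia.
have ia' : (i : nat) != a by apply: contra ia => /eqP E; apply/eqP/val_inj.
have [lt_ia|le_ai] := ltnP i a.
  by rewrite (@nth_default _ 0 q) ?mulr0 // (leq_trans sq) //; lia.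
by rewrite (@nth_default _ 0 p) ?mul0r // (leq_trans sp) //; lia.
Qed.

(** The operator x d/dx is used instead of d/dx wherever possible: it keeps
    degrees, multiplies coefficients by their index, and so avoids the
    shift of indices and the predecessors in sizes. *)
Definition euler (A : nzRingType) (p : {poly A}) : {poly A} := 'X * p^`().

Lemma coef_euler (A : nzRingType) (p : {poly A}) k :
  (euler p)`_k = p`_k *+ k.
Proof. by rewrite coefXM; case: k => [|k]; rewrite ?mulr0n // coef_deriv. Qed.

Lemma size_euler (A : nzRingType) (p : {poly A}) n :
  (size p <= n)%N -> (size (euler p) <= n)%N.
Proof.
move=> sp; apply/leq_sizeP => j nj; rewrite coef_euler nth_default ?mul0rn //.
exact: leq_trans nj.
Qed.

Lemma eulerD (A : nzRingType) : {morph @euler A : p q / p + q}.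
Proof. by move=> p q; rewrite /euler derivD mulrDr. Qed.

Lemma eulerM (A : comNzRingType) (p q : {poly A}) :
  euler (p * q) = euler p * q + p * euler q.
Proof. by rewrite /euler derivM; ring. Qed.

Lemma eulerC (A : nzRingType) (c : A) : euler c%:P = 0.
Proof. by rewrite /euler derivC mulr0. Qed.

Lemma eulerXn (A : nzRingType) k : euler 'X^k = 'X^k *+ k :> {poly A}.
Proof.
apply/polyP => i; rewrite coef_euler coefMn coefXn.
by case: eqP => [->|]; rewrite ?mul0rn.
Qed.

Lemma horner_euler0 (A : nzRingType) (p : {poly A}) : (euler p).[0] = 0.
Proof. by rewrite horner_coef0 coef_euler mulr0n. Qed.

Lemma eulerXnM (A : comNzRingType) k (p : {poly A}) :
  euler ('X^k * p) = 'X^k * (k%:R * p + euler p).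
Proof. by rewrite eulerM eulerXn mulrDr mulrnAl mulrA mulr_natr mulrnAl. Qed.

Lemma lowest_term (K : fieldType) (p : {poly K}) :
  p != 0 -> exists k (q : {poly K}), p = 'X^k * q /\ q.[0] != 0.
Proof.
move=> p0; have [k [q]] := multiplicity_XsubC p 0; rewrite p0 subr0 => /= q0 ->.
by exists k, q; split; [rewrite mulrC | exact: q0].
Qed.

Lemma dvdXn_of_coef0 (A : comNzRingType) (p : {poly A}) m :
  (forall i, (i < m)%N -> p`_i = 0) -> exists q : {poly A}, p = 'X^m * q.
Proof.
move=> pm; exists (drop_poly m p).
rewrite -{1}(poly_take_drop m p) (_ : take_poly m p = 0) ?add0r 1?mulrC //.
by apply/polyP => i; rewrite coef_take_poly coef0; case: ifP => // /pm.
Qed.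

(** * Wronskians of polynomials *)

(** If p l' = p' l with p and l nonzero, comparison of the leading terms shows
    that p and l have the same degree.  This applies to b, and again to the
    combination b - c l that cancels the leading term of b; the latter must
    therefore vanish. *)
Lemma wronskian0_colinear (K : numFieldType) (b l : {poly K}) :
  l != 0 -> b^`() * l = b * l^`() -> exists c, b = c *: l.
Proof.
move=> l0 Wb.
have same_size (p : {poly K}) :
    p != 0 -> p^`() * l = p * l^`() -> size p = size l.
  move=> p0 Wp; set a := (size p).-1; set d := (size l).-1.
  have sp : (size p <= a.+1)%N by exact: leqSpred.
  have sl : (size l <= d.+1)%N by exact: leqSpred.
  have : ('X * p^`() * l)`_(a + d) = (p * ('X * l^`()))`_(a + d).
    by rewrite -mulrA Wp mulrCA.
  rewrite -!/(euler _) !coefM_top ?size_euler // !coef_euler.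
  rewrite mulrnAl mulrnAr => /eqP.
  rewrite -subr_eq0 -(mulr_natr _ a) -(mulr_natr _ d) -mulrBr !mulf_eq0.
  rewrite -!/(lead_coef _) !lead_coef_eq0 (negPf p0) (negPf l0) /=.
  rewrite subr_eq0 eqr_nat => /eqP ad.
  by rewrite -(@prednK (size p)) ?size_poly_gt0 // -/a ad prednK ?size_poly_gt0.
have [->|b0] := eqVneq b 0; first by exists 0; rewrite scale0r.
exists (lead_coef b / lead_coef l); apply/eqP; rewrite -subr_eq0.
set r := b - _; apply/negPn/negP => r0.
have sb := same_size b b0 Wb.
have sr : size r = size l.
  apply: same_size => //; rewrite /r derivB derivZ !mulrBl Wb.
  by rewrite -!scalerAl [l^`() * l]mulrC.
move/eqP: r0; apply; apply/eqP; rewrite -lead_coef_eq0 lead_coefE sr.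
rewrite /r coefB coefZ -[l`_ _]lead_coefE divfK ?lead_coef_eq0 //.
by rewrite lead_coefE sb subrr.
Qed.

Definition antideriv (K : numFieldType) (p : {poly K}) : {poly K} :=
  \poly_(i < (size p).+1) (p`_i.-1 / i%:R).

Lemma antiderivK (K : numFieldType) (p : {poly K}) : (antideriv p)^`() = p.
Proof.
apply/polyP => i; rewrite coef_deriv coef_poly ltnS /=.
case: ltnP => [_|ple]; last by rewrite mul0rn nth_default.
by rewrite -[LHS]mulr_natr divfK // pnatr_eq0.
Qed.

(** The hypothesis says that the rational function a / l has the polynomial
    derivative p; it differs from an antiderivative of p by a constant and is
    therefore a polynomial. *)
Lemma dvd_of_wronskian (K : numFieldType) (a l p : {poly K}) :
  l != 0 -> a^`() * l - a * l^`() = p * l ^+ 2 ->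
  exists P : {poly K}, a = l * P /\ P^`() = p.
Proof.
move=> l0 W.
have [|c bE] := @wronskian0_colinear _ (a - l * antideriv p) l l0.
  apply/eqP; rewrite -subr_eq0; apply/eqP.
  rewrite derivB derivM antiderivK.
  transitivity (a^`() * l - a * l^`() - p * l ^+ 2); first by ring.
  by rewrite W subrr.
exists (antideriv p + c%:P); split; last first.
  by rewrite derivD derivC addr0 antiderivK.
by rewrite mulrDr [l * c%:P]mulrC mul_polyC -bE addrC subrK.
Qed.

(** * Self-similar solutions *)

(** With E the operator z d/dz, this is the bilinear equation for
    t^(n/3) F(x / t^(1/3)), multiplied by 3 x^4 t so that only E occurs.
    Expanded, it reads 9 F''^2 = F F' + z (F F'' - F'^2) up to a factor z^4.
    The exponent n cancels. *)
Definition selfsim_eq (K : numFieldType) (F : {poly K}) : Prop :=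
  9 * (euler (euler F) - euler F) ^+ 2 =
  'X^3 * (F * euler (euler F) - euler F ^+ 2).

Lemma selfsim_shift (K : numFieldType) s (G : {poly K}) :
  selfsim_eq ('X^s * G) ->
  let G1 := s%:R * G + euler G in let G2 := s%:R * G1 + euler G1 in
  9 * (G2 - G1) ^+ 2 = 'X^3 * (G * G2 - G1 ^+ 2).
Proof.
move=> H G1 G2; apply: (mulfI (_ : ('X^s : {poly K}) ^+ 2 != 0)).
  by rewrite !expf_neq0 ?polyX_eq0.
move: H; rewrite /selfsim_eq !eulerXnM -/G1 -/G2.
move: ('X^s) ('X^3) => y z H.
transitivity (9 * (y * G2 - y * G1) ^+ 2); first by ring.
by rewrite H; ring.
Qed.

(** At z = 0 the left-hand side of the shifted equation is
    9 (s (s - 1) G(0))^2 and the right-hand side vanishes. *)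
Lemma selfsim_order (K : numFieldType) s (G : {poly K}) :
  selfsim_eq ('X^s * G) -> G.[0] != 0 -> (s <= 1)%N.
Proof.
move=> /selfsim_shift H G0.
have := congr1 (horner^~ 0) H.
rewrite !(hornerE, horner_euler0) /= -!polyC_natr.
rewrite ?(hornerE, horner_euler0) /= => E.
have : 9 * (s%:R * (s%:R - 1) * G.[0]) ^+ 2 = 0.
  by apply: etrans (etrans E _); ring.
move/eqP; rewrite mulf_eq0 pnatr_eq0 expf_eq0 /= !mulf_eq0 (negPf G0) orbF.
by rewrite subr_eq0 pnatr_eq0 -[1]/(1%:R) eqr_nat; case: s {H E} => [|[]].
Qed.

(** Insert G = c + d z^3 + z^k q, k = j + 4, in the shifted equation.  The terms
    of order 6 give d (m^2 d - c) = 0 with m = (s + 3) (s + 2), the next ones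
    have order k + 3 and give
    (18 m d (s + k) (s + k - 1) - c k^2) q(0) = 0.
    If d = 0 the first factor is - c k^2; otherwise c = m^2 d and it is
    m d (18 (s + k) (s + k - 1) - m k^2), which has no zero with s <= 1 and
    k >= 4.  So no further term can start at order k. *)
Lemma selfsim_tail (K : numFieldType) s (c d : K) j (q : {poly K}) :
  (s <= 1)%N -> c != 0 ->
  selfsim_eq ('X^s * (c%:P + d%:P * 'X^3 + 'X^j * 'X^4 * q)) -> q.[0] = 0.
Proof.
move=> s1 c0 /selfsim_shift /=.
set G := (X in euler X).
set G1 := _%:R * G + _; set G2 := _%:R * G1 + _.
pose q1 := (s + j + 4)%:R * q + euler q.
pose q2 := (s + j + 4)%:R * q1 + euler q1.
have eX : euler 'X^3 = 3 * 'X^3 :> {poly K} by rewrite eulerXn -mulr_natl.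
have step (a b : K) (r : {poly K}) :
    let p := a%:P + b%:P * 'X^3 + 'X^j * 'X^4 * r in
    s%:R * p + euler p =
    (s%:R * a)%:P + ((s + 3)%:R * b)%:P * 'X^3
    + 'X^j * 'X^4 * ((s + j + 4)%:R * r + euler r).
  rewrite /= !eulerD -exprD eulerXnM [euler (b%:P * _)]eulerM !eulerC eX.
  rewrite !natrD exprD !polyCM polyCD !polyC_natr.
  by move: ('X^j) => y; ring.
have G1E : G1 = (s%:R * c)%:P + ((s + 3)%:R * d)%:P * 'X^3 + 'X^j * 'X^4 * q1.
  exact: step.
have G2E : G2 = (s%:R * (s%:R * c))%:P
                + ((s + 3)%:R * ((s + 3)%:R * d))%:P * 'X^3 + 'X^j * 'X^4 * q2.
  by rewrite /G2 G1E; exact: step.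
have q10 : q1.[0] = (s + j + 4)%:R * q.[0].
  by rewrite hornerD horner_euler0 addr0 hornerM -polyC_natr hornerC.
have q20 : q2.[0] = (s + j + 4)%:R ^+ 2 * q.[0].
  by rewrite hornerD horner_euler0 addr0 hornerM -polyC_natr hornerC q10 mulrA.
rewrite G2E G1E /G.
clearbody q1 q2; clear -s1 c0 q10 q20 => H.
pose m : K := (s + 3)%:R * (s + 2)%:R.
pose w := 18 * m%:P * d%:P * (q2 - q1) - c%:P * (q2 + s%:R * q - 2 * s%:R * q1).
(* The case split on s provides s^2 = s, on which these cancellations rely. *)
have [v vE] : exists v : {poly K},
    'X^6 * ((9 * (m ^+ 2 * d - c) * d)%:P + 'X * 'X^j * (w + 'X * v)) = 0.
  pose y : {poly K} := 'X^j.
  exists (9 * y * (q2 - q1) ^+ 2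
          - 'X ^+ 2 * (d%:P * (q2 + (s + 3)%:R ^+ 2 * q - 2 * (s + 3)%:R * q1))
          - y * 'X^3 * (q * q2 - q1 ^+ 2)).
  move/eqP: H; rewrite -subr_eq0 => /eqP <-.
  rewrite /w /m -/y.
  by clear -s1; case: s s1 => [|[|//]] _;
     rewrite !(polyCM, polyCB, polyC_exp, polyC_natr); ring.
move/eqP: vE; rewrite mulf_eq0 expf_eq0 polyX_eq0 andbF orFb => /eqP vE.
have dE : (m ^+ 2 * d - c) * d = 0.
  have := congr1 (horner^~ 0) vE.
  rewrite hornerD hornerC !hornerM hornerX !mul0r addr0 horner0 => /eqP.
  by rewrite -mulrA mulf_eq0 pnatr_eq0 => /eqP.
move/eqP: vE; rewrite -mulrA dE mulr0 polyC0 add0r !mulf_eq0 expf_eq0.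
rewrite polyX_eq0 andbF !orFb => /eqP/(congr1 (horner^~ 0)).
rewrite hornerD hornerM hornerX mul0r addr0 horner0 /w -!polyC_natr !hornerE /=.
rewrite q20 q10 => E.
have {E} : (18 * m * d * (s + j + 4)%:R * (s + j + 3)%:R
            - c * (j + 4)%:R ^+ 2) * q.[0] = 0.
  apply: etrans E; rewrite /m; clear -s1.
  by case: s s1 => [|[|//]] _; rewrite !natrD; ring.
move/eqP; rewrite mulf_eq0 => /orP[/eqP E|/eqP//]; exfalso.
move: c0; suff -> : c = 0 by rewrite eqxx.
move/eqP: dE; rewrite mulf_eq0 orbC => /orP[/eqP d0|].
  move: E; rewrite d0 mulr0 !mul0r sub0r => /eqP.
  rewrite oppr_eq0 mulf_eq0 expf_eq0 pnatr_eq0 addn_eq0 !andbF orbF.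
  by move/eqP.
rewrite subr_eq0 => /eqP cE; rewrite -cE.
have : (18 * (s + j + 4) * (s + j + 3) != (s + 3) * (s + 2) * (j + 4) ^ 2)%N.
  by clear -s1; case: s s1 => [|[|//]] _; apply/eqP; nia.
rewrite -(eqr_nat K) !natrM -subr_eq0 -/m -expr2 => N0.
move: E; rewrite -cE => E.
have /eqP : m * d * (18 * (s + j + 4)%:R * (s + j + 3)%:R
                     - m * (j + 4)%:R ^+ 2) = 0.
  by apply: etrans E; ring.
rewrite mulf_eq0 (negPf N0) orbF => /eqP md0.
by rewrite expr2 -mulrA md0 mulr0.
Qed.

(** The exponents of F are congruent modulo 3, so that F = z^s G with
    G = c + d z^3 + O(z^4).  By [selfsim_tail] there is nothing beyond z^3, and
    the degree of F is s or s + 3 with s <= 1. *)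
Lemma selfsim_size (K : numFieldType) (F : {poly K}) :
  F != 0 -> selfsim_eq F ->
  (forall i j, F`_i != 0 -> F`_j != 0 -> i = j %[mod 3]) ->
  size F \in [:: 1; 2; 4; 5]%N.
Proof.
move=> F0 HF supp.
have [s [G [FE G0]]] := lowest_term F0.
have s1 : (s <= 1)%N by apply: (@selfsim_order K s G); rewrite -?FE.
have GF i : G`_i = F`_(s + i) by rewrite FE coefXnM ltnNge leq_addr addKn.
have Gsupp i : (i %% 3 != 0)%N -> G`_i = 0.
  move=> i3; apply/eqP/negPn/negP; rewrite GF => Fi.
  have := supp s (s + i)%N.
  rewrite Fi -(addn0 s) -GF -horner_coef0 G0 addn0.
  move=> /(_ isT isT)/eqP; rewrite -{1}(addn0 s) eqn_modDl mod0n eq_sym.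
  by rewrite (negPf i3).
set c := G`_0; set d := G`_3.
have [|r rE] := @dvdXn_of_coef0 _ (G - (c%:P + d%:P * 'X^3)) 4.
  move=> i; rewrite !coefB !coefD coefC coefCM coefXn.
  case: i => [|[|[|[|//]]]] _ /=.
  all: rewrite ?mulr0 ?mulr1 ?addr0 ?add0r ?subrr //.
    by rewrite Gsupp ?subrr.
  by rewrite Gsupp ?subrr.
have GE : G = c%:P + d%:P * 'X^3 + 'X^4 * r.
  by rewrite -rE addrC subrK.
have c0 : c != 0 by rewrite /c -horner_coef0.
have [r0|r0] := eqVneq r 0; last first.
  have [j [q [rj q0]]] := lowest_term r0.
  suff q00 : q.[0] = 0 by rewrite q00 eqxx in q0.
  apply: (@selfsim_tail K s c d j q s1 c0); move: HF.
  by rewrite FE GE rj [in X in selfsim_eq X](mulrA 'X^4) [_ * 'X^j]mulrC.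
have Gn0 : G != 0 by apply: contraNneq c0 => G00; rewrite /c G00 coef0.
have sF : size F = (s + size G)%N.
  by rewrite FE mulrC size_mulXn // addnC.
have [d0|d0] := eqVneq d 0.
  have -> : size F = s.+1.
    by rewrite sF GE r0 d0 polyC0 mul0r mulr0 !addr0 size_polyC c0 addn1.
  by case: s s1 {FE HF GF sF supp Gsupp} => [|[]].
have -> : size F = s.+4.
  rewrite sF GE r0 mulr0 addr0 addrC mul_polyC.
  rewrite size_polyDl size_scale ?size_polyXn ?addnS ?addn0 //.
  by rewrite size_polyC c0.
by case: s s1 {FE HF GF sF supp Gsupp} => [|[]].
Qed.

(** * Weighted degree *)

Lemma size_map_le (A B : nzRingType) (g : A -> B) (p : {poly A}) n :
  (size p <= n)%N -> (size (map_poly g p) <= n)%N.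
Proof. by apply: leq_trans; exact: size_poly. Qed.

Lemma coef_map_deriv (A : nzRingType) (p : {poly {poly A}}) m :
  (map_poly (@deriv A) p)`_m = (p`_m)^`().
Proof. by rewrite coef_map_id0 ?deriv0. Qed.

Lemma coef_map_euler (A : nzRingType) (p : {poly {poly A}}) m :
  (map_poly (@euler A) p)`_m = euler p`_m.
Proof. by rewrite coef_map_id0 // /euler deriv0 mulr0. Qed.

Lemma map_deriv_euler (A : nzRingType) (f : {poly {poly A}}) :
  map_poly (@deriv A) (euler f) = 'X * map_poly (@deriv A) f^`().
Proof.
apply/polyP => m; rewrite coefXM !coef_map_deriv coefXM.
by case: m => [|m]; rewrite ?deriv0.
Qed.

(** The substitution x = z S, t = S^3, with values in polynomials in S over
    K[z]: the coefficient of S^m is the component of weight m, at t = 1.  As a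
    ring morphism it turns statements on weights into statements on degrees in
    S. *)
Definition graded (K : fieldType) :
    {rmorphism {poly {poly K}} -> {poly {poly K}}} :=
  (horner_eval ('X%:P * 'X : {poly {poly K}})
   \o map_poly (map_poly polyC \o comp_poly ('X^3 : {poly K}))).

Lemma coef_graded (K : fieldType) (f : {poly {poly K}}) m i :
  (graded K f)`_m`_i =
  if (i <= m)%N && (3 %| m - i)%N then f`_i`_((m - i) %/ 3) else 0.
Proof.
rewrite /= /horner_eval (@horner_coef_wide _ (size f)) ?size_poly //.
rewrite !coef_sum.
pose g := map_poly polyC \o comp_poly ('X^3 : {poly K}).
have E (k : nat) : ((map_poly g f)`_k * ('X%:P * 'X) ^+ k)`_m`_i =
    if (k <= m)%N && (3 %| m - k)%N && (i == k)
    then f`_k`_((m - k) %/ 3) else 0.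
  rewrite coef_map /= exprMn -polyC_exp mulrCA coefCM mulrC.
  rewrite [(_ * 'X^k)`_m]coefMXn ltnNge coef_map /= coef_comp_poly_Xn //.
  case: leqP => _ /=; last by rewrite mul0r coef0.
  rewrite coefCM coefXn.
  by case: (3 %| _)%N => /=; case: (i == k); rewrite ?mulr0 ?mulr1 ?mul0r.
rewrite (eq_bigr _ (fun (k : 'I__) _ => E k)).
have [lt_i|le_i] := ltnP i (size f).
  rewrite (bigD1 (Ordinal lt_i)) //= eqxx andbT big1 ?addr0 // => k ki.
  rewrite ifF // andbC; apply/negbTE; rewrite negb_and; apply/orP; left.
  by rewrite eq_sym.
rewrite big1 ?[f`_i]nth_default ?coef0 ?if_same // => k _.
by rewrite ifF // andbC [i == k]gtn_eqF //= (leq_trans _ le_i).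
Qed.

Lemma graded_xdx (K : fieldType) (f : {poly {poly K}}) :
  graded K (euler f) = map_poly (@euler K) (graded K f).
Proof.
apply/polyP => m; apply/polyP => i.
rewrite coef_map_euler coef_euler !coef_graded coef_euler coefMn.
by case: ifP; rewrite ?mul0rn.
Qed.

(** On x^i t^j the operator 3 t d/dt is multiplication by 3 j, the weight
    i + 3 j less the exponent i. *)
Lemma graded_tdt (K : fieldType) (f : {poly {poly K}}) :
  3 * graded K (map_poly (@euler K) f) =
  euler (graded K f) - map_poly (@euler K) (graded K f).
Proof.
apply/polyP => m; apply/polyP => i.
rewrite mulr_natl coefB 2!coefMn coef_euler coefB coefMn.
rewrite coef_map_euler coef_euler !coef_graded coef_map_euler coef_euler.
case: ifP => [/andP[im dv]|_]; last by rewrite !mul0rn subr0.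
by rewrite -mulrnBr // -mulrnA divnK.
Qed.

(** One half of the left-hand side of the bilinear equation. *)
Definition hirota (K : fieldType) (f : {poly {poly K}}) : {poly {poly K}} :=
  map_poly (@deriv K) f^`() * f - map_poly (@deriv K) f * f^`()
  + 3 * f^`()^`() ^+ 2.

Lemma hirota_euler (K : fieldType) (f : {poly {poly K}}) :
  let thx := @euler {poly K} in let tht := map_poly (@euler K) in
  'X^4 * ('X%:P * hirota f) =
   'X ^+ 3 * (tht (thx f) * f - tht f * thx f)
   + 3 * ('X%:P * (thx (thx f) - thx f) ^+ 2).
Proof.
move=> thx tht.
have thtE (g : {poly {poly K}}) : tht g = 'X%:P * map_poly (@deriv K) g.
  by apply/polyP => m; rewrite coefCM coef_map_deriv coef_map_euler.
rewrite !thtE /thx map_deriv_euler /euler derivM derivX mul1r /hirota.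
by ring.
Qed.

(** The image of [hirota] under the grading, up to a monomial factor.  It has
    degree 2 in P and no S in its coefficients, which is the homogeneity of
    the bilinear equation; on the component of weight n the operator S d/dS is
    multiplication by n. *)
Definition graded_op (K : fieldType) (P : {poly {poly K}}) : {poly {poly K}} :=
  let thz := map_poly (@euler K) in let thS := @euler {poly K} in
  'X%:P ^+ 3 * ((thS (thz P) - thz (thz P)) * P - (thS P - thz P) * thz P)
  + 9 * (thz (thz P) - thz P) ^+ 2.

Lemma graded_hirota (K : numFieldType) (f : {poly {poly K}}) :
  3 * 'X%:P ^+ 4 * 'X ^+ 4 * graded K (hirota f) = graded_op (graded K f).
Proof.
have pX : graded K 'X = 'X%:P * 'X by rewrite /= map_polyX /horner_eval hornerX.
have pt : graded K 'X%:P = 'X ^+ 3.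
  by rewrite /= map_polyC /= /horner_eval hornerC comp_polyX map_polyXn.
apply: (mulfI (_ : ('X : {poly {poly K}}) ^+ 3 != 0)).
  by rewrite expf_neq0 ?polyX_eq0.
have E1 := graded_tdt f; have E2 := graded_tdt (euler f).
have E3 := graded_xdx (euler f); rewrite (graded_xdx f) in E2 E3.
rewrite /graded_op -E1 -E2 -E3.
have morph (A B : comNzRingType) (g : {rmorphism A -> B})
    (X T Q a b c d e : A) :
    X ^+ 4 * (T * Q) = X ^+ 3 * (a * b - c * d) + 3 * (T * (e - d) ^+ 2) ->
    g X ^+ 4 * (g T * g Q) =
    g X ^+ 3 * (g a * g b - g c * g d) + 3 * (g T * (g e - g d) ^+ 2).
  move=> H; have -> : 3 = g 3 by rewrite rmorph_nat.
  by rewrite -!(rmorphXn, rmorphB, rmorphM, rmorphD) H.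
have := morph _ _ (graded K) _ _ _ _ _ _ _ _ (hirota_euler f).
rewrite pX pt (graded_xdx f) => H.
transitivity (3 * (('X%:P * 'X) ^+ 4 * ('X^3 * graded K (hirota f)))).
  by ring.
by rewrite H; ring.
Qed.

(** The coefficient of S^(2 n) only involves the top component of P, with
    S d/dS replaced by n; the terms in n cancel. *)
Lemma graded_op_top (K : numFieldType) (P : {poly {poly K}}) n :
  (size P <= n.+1)%N ->
  (size (graded_op P) <= (n + n).+1)%N /\ (graded_op P = 0 -> selfsim_eq P`_n).
Proof.
move=> sP; rewrite /graded_op.
set p1 := map_poly _ P; set p2 := map_poly _ p1.
have s1 : (size p1 <= n.+1)%N by exact: size_map_le.
have s2 : (size p2 <= n.+1)%N by exact: size_map_le.
have sD (p q : {poly {poly K}}) m :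
    (size p <= m)%N -> (size q <= m)%N -> (size (p - q)%R <= m)%N.
  move=> sp sq; rewrite (leq_trans (size_polyD _ _)) //.
  by rewrite size_polyN geq_max sp.
have sM (p q : {poly {poly K}}) :
    (size p <= n.+1)%N -> (size q <= n.+1)%N ->
    (size (p * q)%R <= (n + n).+1)%N.
  by move=> sp sq; rewrite (leq_trans (size_polyMleq _ _)) //; lia.
have se1 := size_euler s1; have se := size_euler sP.
split.
  rewrite -polyC_exp -[9]/(9%:R) -polyC_natr !mul_polyC.
  apply: (leq_trans (size_polyD _ _)); rewrite geq_max.
  apply/andP; split; apply: (leq_trans (size_scale_leq _ _)).
    by rewrite sD // sM ?sD.
  by rewrite expr2 sM ?sD.
move=> /(congr1 (fun p : {poly {poly K}} => p`_(n + n))).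
rewrite coef0 coefD -polyC_exp coefCM mulr_natl coefMn coefB expr2.
rewrite [in X in X -> _](coefM_top (p:=p2 - p1)) ?sD //.
rewrite coefM_top ?sD // coefM_top ?sD //.
rewrite !coefB !coef_euler !coef_map_euler => H.
rewrite /selfsim_eq; apply/eqP; rewrite -subr_eq0; apply/eqP; apply: etrans H.
rewrite -(mulr_natl (euler P`_n)) -(mulr_natl P`_n) -(mulr_natl _ 9).
by ring.
Qed.

Lemma size_gradedP (K : numFieldType) (h : {poly {poly K}}) n :
  reflect (forall i j, (n < i + 3 * j)%N -> h`_i`_j = 0)
          (size (graded K h) <= n.+1)%N.
Proof.
apply: (iffP (leq_sizeP _ _)) => [H i j lt_n|H m lt_nm].
  have := congr1 (fun p : {poly K} => p`_i) (H _ lt_n).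
  by rewrite coef_graded leq_addr addKn dvdn_mulr // mulKn // coef0.
apply/polyP => i; rewrite coef_graded coef0; case: ifP => // /andP[im dv].
by rewrite H // mulnC divnK // subnKC.
Qed.

(** In [hirota] the derivatives lower the weight by 4 in every term. *)
Lemma hirota_weight (K : numFieldType) (h : {poly {poly K}}) n i j :
  (size (graded K h) <= n.+1)%N -> (n + n < i + 3 * j + 4)%N ->
  (hirota h)`_i`_j = 0.
Proof.
move=> sh lt_n; have [sz _] := graded_op_top sh.
have : (graded_op (graded K h))`_(i + 3 * j + 4)`_(4 + i) = 0.
  by rewrite (leq_sizeP _ _ sz) ?coef0.
rewrite -graded_hirota.
have -> P : 3 * 'X%:P ^+ 4 * 'X ^+ 4 * P =
            ('X^4 : {poly K})%:P * ('X^4 * (3 * P)).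
  by rewrite polyC_exp; ring.
rewrite coefCM !coefXnM !ifF ?addnK ?addKn; try lia.
rewrite mulr_natl !coefMn coef_graded leq_addr addKn dvdn_mulr // mulKn //.
by move/eqP; rewrite mulrn_eq0 => /eqP.
Qed.

(** * Splitting off the leading coefficient *)

(** The part of x [hirota] that involves t, polarised: x [hirota f] is
    [bracket f f] plus 3 x f_xx^2.  The factor x makes the coefficient of
    x^(a + b) depend on the top coefficients only. *)
Definition bracket (K : numFieldType) (p q : {poly {poly K}}) :=
  map_poly (@deriv K) (euler p) * q - map_poly (@deriv K) p * euler q.

Lemma coef_bracket (K : numFieldType) (p q : {poly {poly K}}) a b :
  (size p <= a.+1)%N -> (size q <= b.+1)%N ->
  (bracket p q)`_(a + b) = ((p`_a)^`() * q`_b) *+ a - ((p`_a)^`() * q`_b) *+ b.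
Proof.
move=> sp sq; rewrite coefB !coefM_top ?size_map_le ?size_euler //.
by rewrite !coef_map_deriv !coef_euler derivMn mulrnAl mulrnAr.
Qed.

Lemma size_deriv_le (A : nzRingType) (p : {poly A}) n :
  (size p <= n)%N -> (size p^`() <= n.-1)%N.
Proof.
move=> sp; apply/leq_sizeP => j nj; rewrite coef_deriv nth_default ?mul0rn //.
by rewrite (leq_trans sp) //; case: n nj {sp} => //=.
Qed.

Lemma coef_dxx_eq0 (K : numFieldType) (p q : {poly {poly K}}) a b m :
  (size p <= a.+1)%N -> (size q <= b.+1)%N -> (a + b <= m)%N ->
  ('X * (p^`()^`() * q^`()^`()))`_m = 0.
Proof.
move=> sp sq abm; rewrite coefXM; case: m abm => [//|m] abm /=.
rewrite nth_default // (leq_trans (size_polyMleq _ _)) //.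
have := size_deriv_le (size_deriv_le sp).
have := size_deriv_le (size_deriv_le sq).
move: (size _) (size _) => u v /=; lia.
Qed.

Lemma coef_bracket_eq0 (K : numFieldType) (p q : {poly {poly K}}) a b m :
  (size p <= a.+1)%N -> (size q <= b.+1)%N -> (a + b < m)%N ->
  (bracket p q)`_m = 0.
Proof.
move=> sp sq abm; apply: nth_default.
have sM (u v : {poly {poly K}}) :
    (size u <= a.+1)%N -> (size v <= b.+1)%N -> (size (u * v)%R <= m)%N.
  by move=> su sv; rewrite (leq_trans (size_polyMleq _ _)) //; lia.
rewrite (leq_trans (size_polyD _ _)) // size_polyN geq_max.
by rewrite !sM ?size_map_le ?size_euler.
Qed.

Lemma hirotaD (K : numFieldType) (g r : {poly {poly K}}) :
  'X * hirota (g + r) =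
  'X * hirota g + (bracket g r + bracket r g + bracket r r)
  + 3 * (2 * ('X * (g^`()^`() * r^`()^`())) + 'X * (r^`()^`() * r^`()^`())).
Proof.
rewrite /hirota /bracket !map_deriv_euler /euler !derivD !raddfD /=.
by ring.
Qed.

Lemma hirotaCM (K : numFieldType) (l : {poly K}) (h : {poly {poly K}}) :
  hirota (l%:P * h) = (l ^+ 2)%:P * hirota h.
Proof.
rewrite /hirota mul_polyC !derivZ -!mul_polyC.
have dM (g : {poly {poly K}}) : map_poly (@deriv K) (l%:P * g) =
    (l^`())%:P * g + l%:P * map_poly (@deriv K) g.
  by apply/polyP => m; rewrite coefD !coefCM !coef_map_deriv coefCM derivM.
by rewrite !dM polyC_exp; ring.
Qed.

(** One step of the descending induction: h agrees with f / l down to x^(i+1),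
    and P is the next coefficient.  With a the coefficient of x^i in the
    remainder, the coefficient of x^(n+i) in x [hirota f] = 0 reads
    (n - i) (a' l - a l') = q l^2, where q is a coefficient of [hirota h]:
    all other contributions of the remainder have lower degree.  The weight
    bound for [hirota h] bounds the degree of q, hence of P. *)
Lemma factor_step (K : numFieldType) (f h : {poly {poly K}}) (l : {poly K})
    n i :
  l != 0 -> hirota f = 0 -> (i < n)%N -> h`_n = 1 -> (size h <= n.+1)%N ->
  (size (graded K h) <= n.+1)%N -> (size (f - l%:P * h)%R <= i.+1)%N ->
  exists P : {poly K}, let h' := h + P%:P * 'X^i in
   [/\ h'`_n = 1, (size h' <= n.+1)%N, (size (graded K h') <= n.+1)%N &
   (size (f - l%:P * h')%R <= i)%N].
Proof.
move=> l0 Hf lt_in hn sh wh; set r := f - l%:P * h => sr.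
have fE : f = l%:P * h + r by rewrite addrC subrK.
pose q := (hirota h)`_(n + i).-1.
have sg : (size (l%:P * h)%R <= n.+1)%N.
  by rewrite mul_polyC (leq_trans (size_scale_leq _ _)).
pose a := r`_i.
have key : (a^`() * l - a * l^`()) *+ (n - i) = q * l ^+ 2.
  have := hirotaD (l%:P * h) r.
  have B1 := coef_bracket sg sr; have B2 := coef_bracket sr sg.
  have B3 : (bracket r r)`_(n + i) = 0.
    by apply: (coef_bracket_eq0 sr sr); rewrite ltn_add2r.
  have D1 := coef_dxx_eq0 sg sr (leqnn _).
  have D2 : ('X * (r^`()^`() * r^`()^`()))`_(n + i) = 0.
    by apply: (coef_dxx_eq0 sr sr); rewrite leq_add2r ltnW.
  rewrite (addnC i n) in B2; rewrite -fE Hf mulr0 hirotaCM mulrCA.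
  move: (bracket _ r) (bracket r (l%:P * h)) (bracket r r) B1 B2 B3.
  move=> b1 b2 b3 B1 B2 B3.
  move: ('X * _) ('X * (r^`()^`() * _)) D1 D2 => d1 d2 D1 D2.
  rewrite -[3](@polyC_natr {poly K}) -[2](@polyC_natr {poly K}).
  move/(congr1 (fun p : {poly {poly K}} => p`_(n + i))).
  rewrite coef0 !coefD !coefCM coefD coefCM D1 D2 B1 B2 B3 coefCM hn mulr1.
  rewrite coefXM addn_eq0 (gtn_eqF (leq_ltn_trans _ lt_in)) //= -/q -/a => E.
  apply/eqP; rewrite -subr_eq0; apply/eqP.
  rewrite -[RHS]oppr0 E mulrnBr 1?ltnW //.
  by move: (n) (i) => n' i'; ring.
have ni0 : (n - i)%:R != 0 :> K by rewrite pnatr_eq0 subn_eq0 -ltnNge.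
have W : a^`() * l - a * l^`() = ((n - i)%:R^-1 *: q) * l ^+ 2.
  by rewrite -scalerAl -key -scaler_nat scalerA mulVf // scale1r.
have [P [aE PE]] := dvd_of_wronskian l0 W.
exists P => h'.
have Pw j : (n < i + 3 * j)%N -> P`_j = 0.
  case: j => [|j] lt_nj; first by move: lt_nj lt_in; lia.
  have : P^`()`_j = 0.
    by rewrite PE coefZ /q (hirota_weight wh) ?mulr0 //; move: lt_nj lt_in; lia.
  by rewrite coef_deriv => /eqP; rewrite mulrn_eq0 => /eqP.
have h'E k : h'`_k = h`_k + (if k == i then P else 0).
  by rewrite coefD coefCM coefXn; case: eqP => _; rewrite ?mulr1 ?mulr0.
split.
- by rewrite h'E gtn_eqF // addr0.
- apply/leq_sizeP => k nk; rewrite h'E (leq_sizeP _ _ sh) //.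
  by rewrite gtn_eqF ?addr0 // (ltn_trans lt_in).
- apply/size_gradedP => k j lt_nk.
  rewrite h'E coefD (size_gradedP _ _ wh) // add0r.
  by case: eqP lt_nk => [-> /Pw //|_ _]; rewrite coef0.
apply/leq_sizeP => k ik; rewrite coefB coefCM h'E mulrDr opprD addrA.
rewrite -coefCM -coefB -/r; case: eqP => [->|/eqP ki].
  by rewrite -/a aE subrr.
by rewrite mulr0 subr0 (leq_sizeP _ _ sr) // ltn_neqAle eq_sym ki.
Qed.

Lemma monic_factor (K : numFieldType) (f : {poly {poly K}}) :
  f != 0 -> hirota f = 0 ->
  exists n (l : {poly K}) (h : {poly {poly K}}),
    [/\ l != 0, f = l%:P * h, h`_n = 1, (size (graded K h) <= n.+1)%N
       & hirota h = 0].
Proof.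
move=> f0 Hf; pose n := (size f).-1; pose l := lead_coef f.
have l0 : l != 0 by rewrite lead_coef_eq0.
have loop k : (k <= n)%N -> exists h : {poly {poly K}},
   [/\ h`_n = 1, (size h <= n.+1)%N, (size (graded K h) <= n.+1)%N &
   (size (f - l%:P * h)%R <= n - k)%N].
  elim: k => [|k IHk] kn.
    exists 'X^n; split; rewrite ?size_polyXn ?coefXn ?eqxx //.
      apply/size_gradedP => i j; rewrite coefXn.
      case: eqP => [->|_]; rewrite ?coef0 // coef1.
      by case: j => //; rewrite addn0 ltnn.
    apply/leq_sizeP => m; rewrite subn0 leq_eqVlt coefB coefCM coefXn.
    case/predU1P => [<-|nm]; first by rewrite eqxx mulr1 subrr.
    by rewrite gtn_eqF // mulr0 subr0 nth_default // (leq_trans (leqSpred _)).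
  have [h [hn sh wh sr]] := IHk (ltnW kn).
  have [||P [hn' sh' wh' sr']] :=
    @factor_step K f h l n (n - k.+1) l0 Hf _ hn sh wh.
  - by rewrite ltn_subrL (leq_ltn_trans _ kn).
  - by rewrite subnSK.
  by exists (h + P%:P * 'X^(n - k.+1)).
have [h [hn _ wh]] := loop n (leqnn n).
rewrite subnn leqn0 size_poly_eq0 subr_eq0 => /eqP fE.
exists n, l, h; split=> //.
have : (l ^+ 2)%:P * hirota h = 0 by rewrite -hirotaCM -fE.
by move/eqP; rewrite mulf_eq0 polyC_eq0 expf_eq0 (negPf l0) => /eqP.
Qed.

(** * Solutions of degree at most four *)

(** The top weight component F of h is self-similar, its degree is n because
    it contains x^n, and an exponent i occurs in it together with a power
    t^((n - i) / 3), so that i is congruent to n modulo 3. *)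
Lemma weighted_degree (K : numFieldType) (h : {poly {poly K}}) n :
  h`_n = 1 -> (size (graded K h) <= n.+1)%N -> hirota h = 0 ->
  n \in [:: 0; 1; 3; 4]%N.
Proof.
move=> hn wh Hh; have [_ hom] := graded_op_top wh.
have {hom} homF : selfsim_eq (graded K h)`_n.
  by apply: hom; rewrite -graded_hirota Hh rmorph0 mulr0.
set F := (graded K h)`_n in homF.
have Fn : F`_n = 1 by rewrite /F coef_graded leqnn subnn dvdn0 div0n hn coef1.
have sF : size F = n.+1.
  apply/eqP; rewrite eqn_leq; apply/andP; split.
    by apply/leq_sizeP => i ni; rewrite /F coef_graded leqNgt ni.
  rewrite ltnNge; apply/negP => /leq_sizeP/(_ n (leqnn n)).
  by rewrite Fn => /eqP; rewrite oner_eq0.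
have F0 : F != 0 by rewrite -size_poly_gt0 sF.
have := selfsim_size F0 homF; rewrite sF !inE !eqSS; apply=> i j.
rewrite /F !coef_graded.
case: ifP => [/andP[im /dvdnP[k ik]] _|]; last by rewrite eqxx.
case: ifP => [/andP[jm /dvdnP[m jk]] _|]; last by rewrite eqxx.
by lia.
Qed.

(** The shape shared by the monic polynomials in x of degree n <= 4 and weight
    at most n, so that one computation of [hirota] serves all degrees. *)
Definition quartic (K : numFieldType) (p a b c1 c0 d1 d0 : K) :
    {poly {poly K}} :=
  p%:P%:P * 'X^4 + a%:P%:P * 'X^3 + b%:P%:P * 'X^2 + (c1 *: 'X + c0%:P)%:P * 'X
  + (d1 *: 'X + d0%:P)%:P.

Lemma deriv_quartic (K : numFieldType) (p a b c1 c0 d1 d0 : K) :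
  (quartic p a b c1 c0 d1 d0)^`() =
  quartic 0 (4 * p) (3 * a) 0 (2 * b) c1 c0.
Proof.
rewrite /quartic !derivE /= -!mul_polyC !polyC0 !polyCM.
rewrite (polyC_natr _ 4) (polyC_natr _ 3) (polyC_natr _ 2).
rewrite (polyC_natr _ 4) (polyC_natr _ 3).
by ring.
Qed.

Lemma dt_quartic (K : numFieldType) (p a b c1 c0 d1 d0 : K) :
  map_poly (@deriv K) (quartic p a b c1 c0 d1 d0) = quartic 0 0 0 0 c1 0 d1.
Proof.
rewrite /quartic; apply/polyP => m.
rewrite coef_map_deriv !coefD !coefCM !coefXn coefX !coefC.
case: m => [|[|[|[|[|m]]]]] /=.
all: by rewrite !(mulr0, mulr1, addr0, add0r, derivE, scale0r) ?alg_polyC.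
Qed.

Lemma hirota_quartic (K : numFieldType) (p a b c1 c0 d1 d0 : K) :
  hirota (quartic p a b c1 c0 d1 d0) =
  quartic (432 * p ^+ 2 - 3 * p * c1) (432 * p * a - 2 * a * c1 - 4 * p * d1)
   (108 * a ^+ 2 + 144 * p * b - b * c1 - 3 * a * d1)
   0 (72 * a * b - 2 * b * d1) 0 (c1 * d0 - d1 * c0 + 12 * b ^+ 2).
Proof.
rewrite /hirota !deriv_quartic !dt_quartic /quartic -!mul_polyC.
by ring.
Qed.

Lemma weighted_monicE (K : numFieldType) (h : {poly {poly K}}) n :
  (n <= 4)%N -> (size (graded K h) <= n.+1)%N ->
  h = quartic h`_4`_0 h`_3`_0 h`_2`_0 h`_1`_1 h`_1`_0 h`_0`_1 h`_0`_0.
Proof.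
move=> n4 /size_gradedP wh.
apply/polyP => i; apply/polyP => j.
rewrite /quartic !coefD !coefCM !coefXn coefX !coefC.
case: i => [|[|[|[|[|i]]]]]; rewrite /= !(mulr0, mulr1, addr0, add0r) /=.
all: rewrite ?coefD ?coefZ ?coefX ?coefC; case: j => [|[|j]].
all: rewrite /= ?(mulr0, mulr1, addr0, add0r) //.
all: by rewrite wh //; lia.
Qed.

(** The denominators of the three families. *)
Definition normal_form (K : numFieldType) (f : {poly {poly K}}) : Prop :=
  [\/ exists c0, f = quartic 0 0 0 0 1 0 c0,
      exists c0 c2, f = quartic 0 3 (3 * c2) 0 (c2 ^+ 2) 108 (3 * c0)
    | exists c1 c2 c3, f = quartic 12 (12 * c3) (12 * c2) 1728 (12 * c1)
                               (432 * c3) (3 * c1 * c3 - c2 ^+ 2)].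

Lemma quartic0 (K : numFieldType) :
  quartic 0 0 0 0 0 0 0 = 0 :> {poly {poly K}}.
Proof. by rewrite /quartic -!mul_polyC; ring. Qed.

Lemma quartic_congr (K : numFieldType)
    (p p' a a' b b' c1 c1' c0 c0' d1 d1' d0 d0' : K) :
  p = p' -> a = a' -> b = b' -> c1 = c1' -> c0 = c0' -> d1 = d1' -> d0 = d0' ->
  quartic p a b c1 c0 d1 d0 = quartic p' a' b' c1' c0' d1' d0'.
Proof. by move=> -> -> -> -> -> -> ->. Qed.

Lemma normal_form_hirota (K : numFieldType) (f : {poly {poly K}}) :
  normal_form f -> hirota f = 0.
Proof.
case=> [[c0 ->]|[c0 [c2 ->]]|[c1 [c2 [c3 ->]]]];
  by rewrite hirota_quartic -[RHS]quartic0; apply: quartic_congr; ring.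
Qed.

Lemma coef_quartic (K : numFieldType) (p a b c1 c0 d1 d0 : K) :
  let f := quartic p a b c1 c0 d1 d0 in
  ((f`_4`_0 = p) * (f`_3`_0 = a) * (f`_2`_0 = b) * (f`_1`_1 = c1)
   * (f`_1`_0 = c0) * (f`_0`_1 = d1) * (f`_0`_0 = d0))%type.
Proof.
rewrite /= /quartic !coefD !coefCM !coefXn !coefX !coefC /=.
rewrite !(mulr0, mulr1, addr0, add0r, coefD, coefZ, coefX, coefC, coef0) /=.
by rewrite ?(mulr0, mulr1, addr0, add0r).
Qed.

Lemma quartic_eq0 (K : numFieldType) (p a b c1 c0 d1 d0 : K) :
  quartic p a b c1 c0 d1 d0 = 0 ->
  p = 0 /\ a = 0 /\ b = 0 /\ c1 = 0 /\ c0 = 0 /\ d1 = 0 /\ d0 = 0.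
Proof.
move=> H; have := coef_quartic p a b c1 c0 d1 d0; rewrite /= H !coef0 => C.
by do !split; rewrite -?C.
Qed.

Lemma normal_form_deriv_neq0 (K : numFieldType) (f : {poly {poly K}}) :
  normal_form f -> f^`() != 0.
Proof.
have n0 n : (n.+1%:R : K) != 0 by rewrite pnatr_eq0.
case=> [[c0 ->]|[c0 [c2 ->]]|[c1 [c2 [c3 ->]]]]; rewrite deriv_quartic;
  apply/eqP => /quartic_eq0 [_ [a0 [b0 [_ [c00 [_ d00]]]]]].
- by move/eqP: d00; rewrite oner_eq0.
- by move/eqP: b0; rewrite mulf_eq0 !pnatr_eq0.
- by move/eqP: a0; rewrite mulf_eq0 !pnatr_eq0.
Qed.

(** A monic h of weight at most n has constant coefficients of x^(n-1) and
    x^(n-2).  The vanishing of the coefficients of [hirota h] fixes the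
    coefficients that involve t first, then one further constant: for n = 3,
    with h = x^3 + a x^2 + b x + c t + d, it says c = 36 and 3 b = a^2; for
    n = 4, with h = x^4 + a x^3 + b x^2 + (c t + e) x + d t + g, it says
    c = 144, d = 36 a and 12 g = 3 a e - b^2.  The factors 3 and 12 clear the
    denominators. *)
Lemma hirota_solution (K : numFieldType) (f : {poly {poly K}}) :
  f != 0 -> f^`() != 0 -> hirota f = 0 ->
  exists (l : {poly K}) (a : K) (h : {poly {poly K}}),
    [/\ l != 0, a != 0, normal_form (a%:P%:P * h) & f = l%:P * h].
Proof.
move=> f0 fx0 Hf.
have [n [l [h [l0 fE hn wh Hh]]]] := monic_factor f0 Hf.
have nP := weighted_degree hn wh Hh.
have n4 : (n <= 4)%N by move: nP; rewrite !inE => /or4P[] /eqP ->.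
have hE := weighted_monicE n4 wh.
have ht i j : (n < i + 3 * j)%N -> h`_i`_j = 0.
  exact: (size_gradedP _ _ wh).
have hn0 : h`_n`_0 = 1 by rewrite hn coef1.
have scale (p a b c1 c0 d1 d0 s : K) :
  s%:P%:P * quartic p a b c1 c0 d1 d0 =
  quartic (s * p) (s * a) (s * b) (s * c1) (s * c0) (s * d1) (s * d0).
  by rewrite /quartic -!mul_polyC; ring.
have eqs := Hh; rewrite hE hirota_quartic in eqs.
have [E4 [E3 [E2 [_ [E1 [_ E0]]]]]] := quartic_eq0 eqs.
have lin (e x y : K) : e = 0 -> y - x = e -> x = y by move=> -> /subr0_eq.
have n0 m : (m.+1%:R : K) != 0 by rewrite pnatr_eq0.
move: nP; rewrite !inE => /or4P[] /eqP nE; rewrite nE in hn0 ht.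
all: move: hE E4 E3 E2 E1 E0.
- rewrite !(ht 4%N, ht 3%N, ht 2%N, ht 1%N 1%N, ht 1%N 0%N, ht 0%N 1%N) //.
  move=> hE *; exfalso; move/eqP: fx0; apply.
  rewrite fE hE derivM derivC mul0r add0r deriv_quartic !mulr0.
  by rewrite quartic0 mulr0.
- rewrite !(ht 4%N, ht 3%N, ht 2%N, ht 1%N 1%N, ht 0%N 1%N) // hn0 => hE *.
  exists l, 1, h; split; rewrite ?oner_eq0 // polyC1 mul1r.
  by apply: Or31; exists h`_0`_0.
- rewrite !(ht 4%N, ht 1%N 1%N) // hn0.
  move: h`_2`_0 h`_1`_0 h`_0`_1 h`_0`_0 => a b c d hE E4 E3 E2 E1 E0.
  exists l, 3, h; split=> //; apply: Or32; exists d, a.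
  have c36 : c = 36.
    by apply: (mulfI (n0 2%N : 3 != 0)); apply: (lin _ _ _ E2); ring.
  rewrite c36 in E0; rewrite hE scale c36; apply: quartic_congr; try ring.
  by apply: (mulfI (n0 11%N : 12 != 0)); apply: (lin _ _ _ E0); ring.
- rewrite hn0.
  move: h`_3`_0 h`_2`_0 h`_1`_1 h`_1`_0 h`_0`_1 h`_0`_0.
  move=> a b c e d g hE E4 E3 E2 E1 E0.
  have c144 : c = 144.
    by apply: (mulfI (n0 2%N : 3 != 0)); apply: (lin _ _ _ E4); ring.
  rewrite c144 in E3 E0.
  have d36 : d = 36 * a.
    by apply: (mulfI (n0 3%N : 4 != 0)); apply: (lin _ _ _ E3); ring.
  rewrite d36 in E0.
  exists l, 12, h; split=> //; apply: Or33; exists e, b, a.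
  rewrite hE scale c144 d36; apply: quartic_congr; try ring.
  by apply: (mulfI (n0 11%N : 12 != 0)); apply/esym/(lin _ _ _ E0); ring.
Qed.

(** * Logarithmic derivatives in the field of rational functions *)

Lemma bilinearE (R : realType) (f : polyxt R) : bilinear_kdv f <-> hirota f = 0.
Proof.
have -> : bilinear_kdv f = (2 * hirota f = 0).
  rewrite /bilinear_kdv /hirota /pdx /pdt; congr (_ = _); ring.
split=> [/eqP|->]; last by rewrite mulr0.
by rewrite mulf_eq0 -!polyC_natr !polyC_eq0 pnatr_eq0 => /eqP.
Qed.

Lemma two_ratxt_neq0 (R : realType) : (2 : ratxt R) != 0.
Proof.
rewrite -(rmorph_nat (@FracField.tofrac _) 2) tofrac_eq0.
by rewrite -!polyC_natr !polyC_eq0 pnatr_eq0.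
Qed.

(** The identity between the KdV-like expression in u = 2 f_x / f and the
    bilinear form over f^2, with the derivatives of f as free variables and u_x,
    u_t given by the quotient rule. *)
Lemma kdv_log_deriv_id (A : comNzRingType) (K : fieldType)
    (g : {rmorphism A -> K}) (f fx ft fxx fxt : A) :
  (2 : K) != 0 -> g f != 0 ->
  let u := g (2 * fx) / g f in
  let ux := g (2 * fxx * f - 2 * fx * fx) / g (f ^+ 2) in
  let ut := g (2 * fxt * f - 2 * fx * ft) / g (f ^+ 2) in
  ut + 3 / 2 * ux ^+ 2 + 3 / 2 * u ^+ 2 * ux + 3 / 8 * u ^+ 4 =
  g (2 * fxt * f - 2 * ft * fx + 6 * fxx ^+ 2) / g f ^+ 2.
Proof.
move=> n2 f0 u ux ut.
have n8 : (8 : K) != 0 by rewrite (_ : 8 = 2 ^+ 3) ?expf_neq0 //; ring.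
have -> : u = 2 * g fx / g f by congr (_ / _); ring.
have -> : ux = (2 * g fxx * g f - 2 * g fx ^+ 2) / g f ^+ 2.
  by congr (_ / _); ring.
have -> : ut = (2 * g fxt * g f - 2 * g fx * g ft) / g f ^+ 2.
  by congr (_ / _); ring.
have -> : g (2 * fxt * f - 2 * ft * fx + 6 * fxx ^+ 2) =
   2 * g fxt * g f - 2 * g ft * g fx + 6 * g fxx ^+ 2 by ring.
move: (g f) (g fx) (g ft) (g fxx) (g fxt) f0 => F Fx Ft Fxx Fxt F0.
by field; rewrite F0 ?n2 ?n8.
Qed.

Lemma kdv_of_bilinear (R : realType) (f : polyxt R) :
  f != 0 -> bilinear_kdv f -> kdv_like (log_deriv_transform f).
Proof.
move=> f0; rewrite /bilinear_kdv /kdv_like => B.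
have -> : log_deriv_transform f = tofrac (2 * pdx f) / tofrac f.
  by rewrite tofracM rmorph_nat.
rewrite /rdt /rdx !frac_derivE //; [|exact: pdx_leibniz | exact: pdt_leibniz].
have dt2 : pdt (2 * pdx f) = 2 * pdt (pdx f).
  by rewrite !mulr_natl /pdt raddfMn.
have dx2 : pdx (2 * pdx f) = 2 * pdx (pdx f).
  by rewrite !mulr_natl /pdx derivMn.
rewrite dt2 dx2.
have F0 : tofrac f != 0 by rewrite tofrac_eq0.
have n2 := two_ratxt_neq0 R.
move: (pdx f) (pdt f) (pdx (pdx f)) (pdt (pdx f)) B => fx ft fxx fxt B.
pose g : {rmorphism polyxt R -> ratxt R} := @FracField.tofrac (polyxt R).
apply: etrans (@kdv_log_deriv_id _ _ g f fx ft fxx fxt n2 F0) _.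
by rewrite B rmorph0 mul0r.
Qed.

Lemma log_derivM (R : realType) (l : {poly R[i]}) (h : polyxt R) :
  l != 0 -> h != 0 -> log_deriv_transform (l%:P * h) = log_deriv_transform h.
Proof.
move=> l0 h0; rewrite /log_deriv_transform /pdx mul_polyC derivZ -!mul_polyC.
rewrite !tofracM.
by rewrite mulrCA -mulf_div divff ?mul1r // tofrac_eq0 polyC_eq0.
Qed.

Lemma generated_normal_form (R : realType) (u : ratxt R) :
  u != 0 /\ generated_by_bilinear u <->
  exists2 f : polyxt R, normal_form f & u = log_deriv_transform f.
Proof.
split=> [[u0 [f [f0 /bilinearE Hf uE]]]|[f famf ->]].
  have fx0 : f^`() != 0.
    apply: contraNneq u0 => fx0.
    have zero (K : fieldType) (x : K) : 2 * 0 / x = 0 by rewrite mulr0 mul0r.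
    by rewrite uE /log_deriv_transform /pdx fx0 (@tofrac0 (polyxt R)) zero.
  have [l [a [h [l0 a0 famh fE]]]] := hirota_solution f0 fx0 Hf.
  have h0 : h != 0 by apply: contraNneq f0 => h0; rewrite fE h0 mulr0.
  exists (a%:P%:P * h) => //.
  by rewrite uE fE (log_derivM l0 h0) log_derivM // polyC_eq0.
have fx0 := normal_form_deriv_neq0 famf.
have f0 : f != 0 by apply: contraNneq fx0 => ->; rewrite deriv0.
split; last by exists f; split=> //; apply/bilinearE; exact: normal_form_hirota.
apply: mulf_neq0; last by rewrite invr_eq0 tofrac_eq0.
apply: mulf_neq0; [exact: (two_ratxt_neq0 R) | by rewrite tofrac_eq0].
Qed.

(** Only the images of x, t and the constants matter for the shape of the three
    fractions, so these are computed under an arbitrary ring morphism g from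
    polynomials to a field. *)
Lemma image_linear (K : numFieldType) (L : fieldType)
    (g : {rmorphism {poly {poly K}} -> L}) (c0 : K) :
  let f := quartic 0 0 0 0 1 0 c0 in
  2 * g f^`() / g f = 2 / (g 'X + g c0%:P%:P).
Proof.
rewrite /= deriv_quartic /quartic -!mul_polyC.
by congr (_ / _); ring.
Qed.

Lemma image_cubic (K : numFieldType) (L : fieldType)
    (g : {rmorphism {poly {poly K}} -> L}) (c0 c2 : K) :
  let f := quartic 0 3 (3 * c2) 0 (c2 ^+ 2) 108 (3 * c0) in
  let x := g 'X in let t := g 'X%:P in let C c := g c%:P%:P in
  2 * g f^`() / g f =
  2 * (9 * x ^+ 2 + 6 * C c2 * x + C c2 ^+ 2) /
  (3 * x ^+ 3 + 3 * C c2 * x ^+ 2 + C c2 ^+ 2 * x + 108 * t + 3 * C c0).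
Proof.
rewrite /= deriv_quartic /quartic -!mul_polyC.
by congr (_ / _); ring.
Qed.

Lemma image_quartic (K : numFieldType) (L : fieldType)
    (g : {rmorphism {poly {poly K}} -> L}) (c1 c2 c3 : K) :
  let f := quartic 12 (12 * c3) (12 * c2) 1728 (12 * c1) (432 * c3)
             (3 * c1 * c3 - c2 ^+ 2) in
  let x := g 'X in let t := g 'X%:P in let C c := g c%:P%:P in
  2 * g f^`() / g f =
  2 * (48 * x ^+ 3 + 36 * C c3 * x ^+ 2 + 24 * C c2 * x + 1728 * t
       + 12 * C c1) /
  (12 * x ^+ 4 + 12 * C c3 * x ^+ 3 + 12 * C c2 * x ^+ 2 + 1728 * t * x
   + 12 * C c1 * x + 432 * C c3 * t + 3 * C c1 * C c3 - C c2 ^+ 2).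
Proof.
rewrite /= deriv_quartic /quartic -!mul_polyC.
by congr (_ / _); ring.
Qed.

Theorem corollary6 (R : realType) :
  (forall u : ratxt R, u != 0 -> generated_by_bilinear u -> kdv_like u) /\
  (forall u : ratxt R,
    (u != 0 /\ generated_by_bilinear u) <->
    [\/ exists c0 : R[i], u = 2 / (ratx R + ratc c0),
        exists c0 c2 : R[i],
          u = 2 * (9 * ratx R ^+ 2 + 6 * ratc c2 * ratx R + ratc c2 ^+ 2) /
              (3 * ratx R ^+ 3 + 3 * ratc c2 * ratx R ^+ 2
               + ratc c2 ^+ 2 * ratx R + 108 * ratt R + 3 * ratc c0)
      | exists c1 c2 c3 : R[i],
          u = 2 * (48 * ratx R ^+ 3 + 36 * ratc c3 * ratx R ^+ 2
                   + 24 * ratc c2 * ratx R + 1728 * ratt R + 12 * ratc c1) /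
              (12 * ratx R ^+ 4 + 12 * ratc c3 * ratx R ^+ 3
               + 12 * ratc c2 * ratx R ^+ 2 + 1728 * ratt R * ratx R
               + 12 * ratc c1 * ratx R + 432 * ratc c3 * ratt R
               + 3 * ratc c1 * ratc c3 - ratc c2 ^+ 2)]).
Proof.
split=> [u _ [f [f0 Hf ->]]|u]; first exact: kdv_of_bilinear.
rewrite generated_normal_form.
pose g : {rmorphism polyxt R -> ratxt R} := @FracField.tofrac (polyxt R).
split.
  case=> f famf ->; case: famf => [[c0 ->]|[c0 [c2 ->]]|[c1 [c2 [c3 ->]]]].
  - by apply: Or31; exists c0; exact: (image_linear g).
  - by apply: Or32; exists c0, c2; exact: (image_cubic g).
  by apply: Or33; exists c1, c2, c3; exact: (image_quartic g).
case=> [[c0 ->]|[c0 [c2 ->]]|[c1 [c2 [c3 ->]]]].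
- exists (quartic 0 0 0 0 1 0 c0); first by apply: Or31; exists c0.
  exact: (esym (image_linear g _)).
- exists (quartic 0 3 (3 * c2) 0 (c2 ^+ 2) 108 (3 * c0)).
    by apply: Or32; exists c0, c2.
  exact: (esym (image_cubic g _ _)).
exists (quartic 12 (12 * c3) (12 * c2) 1728 (12 * c1) (432 * c3)
          (3 * c1 * c3 - c2 ^+ 2)).
  by apply: Or33; exists c1, c2, c3.
exact: (esym (image_quartic g _ _ _)).
Qed.
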